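(* Let $p$ be an odd prime and let $G$ be a group with $|G|=p^n$ and $|Z(G)|=p^{n-2}$. Let $\Omega_1=Z(G)$ and $\Omega_2=G\setminus Z(G)$. For every vertex $u$ of the commuting graph $\zeta(G,G)$, $$\deg u=\begin{cases} p^{n}-1, & u\in\Omega_1,\\ p^{n-1}-1, & u\in\Omega_2.\end{cases}$$
   Context: $Z(G)$ is the center of $G$. The commuting graph $\zeta(G,G)$ is the simple graph with vertex set $G$ in which two distinct vertices are adjacent if and only if they commute in $G$. *)

(* Defs.v *)
From HB Require Import structures.
From mathcomp Require Import all_boot all_fingroup all_solvable.
Set Implicit Arguments.
Unset Strict Implicit.
Unset Printing Implicit Defensive.
Local Open Scope group_scope.

Record sgraph := SGraph {
  vertex :> finType;
  adj : rel vertex;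
  adj_sym : symmetric adj;
  adj_irr : irreflexive adj
}.

Definition degree (Gr : sgraph) (u : Gr) : nat := #|[set v : Gr | adj u v]|.

Section CommutingGraph.
Variables (gT : finGroupType) (G : {group gT}).

(* [subg_of G] is the finType of elements of G, embedded in gT by [sgval]. *)
Definition commuting_adj : rel (subg_of G) :=
  fun u v => (u != v) && (sgval u * sgval v == sgval v * sgval u).

Lemma commuting_adj_sym : symmetric commuting_adj.
Proof. by move=> u v; rewrite /commuting_adj eq_sym [X in _ && X]eq_sym. Qed.

Lemma commuting_adj_irr : irreflexive commuting_adj.
Proof. by move=> u; rewrite /commuting_adj eqxx. Qed.

Definition commuting_graph : sgraph :=
  SGraph commuting_adj_sym commuting_adj_irr.

End CommutingGraph.

(* Main.v *)
(* For noncentral [u], ['C_G[u]] lies strictly between ['Z(G)] and [G]: it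
   contains [u] and the center, but not all of [G]. Its order is a power of [p]
   strictly between [p ^ (n - 2)] and [p ^ n], hence [p ^ (n - 1)]; the vertex
   [u] itself accounts for the [- 1] in the degree. *)

Require Import Defs.
From HB Require Import structures.
From mathcomp Require Import all_boot all_fingroup all_solvable.
Set Implicit Arguments.
Unset Strict Implicit.
Unset Printing Implicit Defensive.
Local Open Scope group_scope.

Lemma degree_commuting_graph (gT : finGroupType) (G : {group gT})
    (u : commuting_graph G) :
  degree u = (#|'C_G[sgval u]| - 1)%N.
Proof.
have uC : sgval u \in 'C_G[sgval u].
  by rewrite inE cent1id andbT; apply: subgP.
rewrite (cardsD1 (sgval u) 'C_G[sgval u]) uC addKn /degree.
(* Neighbours live in [subg_of G], the centralizer in [gT]; the injection [sgval] carries the count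
   over. *)
rewrite -(card_imset _ (@subg_inj _ G)); congr #|pred_of_set _|.
apply/setP=> x; apply/imsetP/setD1P => [[v] | [x_neq_u]].
  rewrite inE /= => /andP[u_neq_v /eqP cuv] ->; split.
    by apply: contraNneq u_neq_v => /val_inj ->.
  by rewrite inE subgP; apply/cent1P.
case/setIP=> Gx /cent1P cxu; exists (subg G x); last by rewrite subgK.
rewrite inE /= /commuting_adj subgK // cxu eqxx andbT.
by apply: contraNneq x_neq_u => ->; rewrite subgK.
Qed.

Lemma center_proper_cent1 (gT : finGroupType) (G : {group gT}) (x : gT) :
  x \in G :\: 'Z(G) -> 'Z(G) \proper 'C_G[x].
Proof.
case/setDP=> Gx notZx; apply/properP; split.
  (* Centralizers reverse the inclusion of [[set x]] in [G]. *)
  by rewrite setIS // -cent_set1 centS // sub1set.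
by exists x; rewrite // inE Gx cent1id.
Qed.

Lemma cent1_proper (gT : finGroupType) (G : {group gT}) (x : gT) :
  x \in G :\: 'Z(G) -> 'C_G[x] \proper G.
Proof.
case/setDP=> Gx; rewrite properE subsetIl /=; apply: contra.
by rewrite inE Gx subsetI subxx /= sub_cent1.
Qed.

Theorem corollary3p2 (p n : nat) (gT : finGroupType) (G : {group gT})
    (p_prime : prime p) (p_odd : odd p) (n_ge2 : 2 <= n)
    (cardG : #|G| = (p ^ n)%N) (cardZ : #|'Z(G)| = (p ^ (n - 2))%N)
    (u : commuting_graph G) :
  (sgval u \in 'Z(G) -> degree u = (p ^ n - 1)%N) /\
  (sgval u \in G :\: 'Z(G) -> degree u = (p ^ (n - 1) - 1)%N).
Proof.
rewrite degree_commuting_graph; split=> [/setIP[_] | u_ncentral].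
  (* A central element is centralized by all of [G], so ['C_G[sgval u]] is [G]. *)
  by rewrite -sub_cent1 => /setIidPl->; rewrite cardG.
have /(dvdn_pfactor _ _ p_prime)[k _ cardC] : #|'C_G[sgval u]| %| p ^ n.
  by rewrite -cardG cardSg ?subsetIl.
have := proper_card (cent1_proper u_ncentral).
have := proper_card (center_proper_cent1 u_ncentral).
rewrite cardG cardZ cardC !ltn_exp2l ?prime_gt1 // => lt_k lt_kn.
(* Writing [n] as [n.+2] makes the truncated [n - 2] a true difference; the strict bounds on [k]
   then leave only [n.+1]. *)
case: n n_ge2 lt_k lt_kn {cardG cardZ} => [|[|n]] // _.
rewrite !subSS !subn0 ltnS => lt_nk le_kn.
by have /eqP-> : k == n.+1 by rewrite eqn_leq le_kn.
Qed.
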